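(* Assume the standing hypotheses on the continuous problem and on the space discretization listed in the context. Assume also that $\partial u\neq0$ (the boundary data $g$ does not vanish), that $c_1<c_2<\dots<c_s$, that $c_i=1$ for some $i\in\{1,\dots,s\}$, and that there exist $C'$, $h_0$ such that $$\|\tau A_{h,0}e^{\tau A_{h,0}}\|_h\le C',\qquad \tau\ge0,\ h\le h_0.$$ Then the local error of the classical Lawson full discretization satisfies $$\rho_{h,n}=O(1+k\|C_h\|),\qquad A_{h,0}^{-1}\rho_{h,n}=O(k),$$ where the constant in the Landau notation is independent of $k$ and $h$.
   Context: **Continuous problem.** $\Omega\subset\mathbb R^d$ is a bounded domain, $X=C(\overline\Omega)$ with the maximum norm, $Y$ is a Banach space, $A:D(A)\subset X\to X$ and $\partial:D(A)\to Y$ are linear. $u$ is the solution of $u'(t)=Au(t)+f(t,u(t))$, $0\le t\le T$, $u(0)=u_0\in X$, $\partial u(t)=g(t)\in Y$, with $f:[0,T]\times X\to X$ (in general nonlinear) and $g:[0,T]\to Y$. *Standing hypotheses on the continuous problem:* (i) $\partial:D(A)\to Y$ is onto and $g\in C^1([0,T],Y)$. (ii) $\ker\partial$ is dense in $X$ and $A_0$, the restriction of $A$ to $D(A_0)=\ker\partial$, generates a $C_0$-semigroup $\{e^{tA_0}\}_{t\ge0}$ on $X$ of negative type $\omega$. (iii) For $\Re z>0$ and $v\in Y$ the problem $Ax=zx$, $\partial x=v$ has a unique solution $x=K(z)v$, and $\|K(z)v\|\le C\|v\|$ with $C$ uniform for $\Re z\ge\omega_0>\omega$. (iv) $f\in C^1([0,T]\times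 X,X)$. (v) $u\in C^1([0,T],X)$, $u(t)\in D(A)$ for all $t\in[0,T]$, $Au\in C([0,T],X)$. **Space discretization.** For a mesh parameter $h$, $\Omega_h$ is a grid with $N$ nodes; $\|\cdot\|_h$ is the maximum norm on $\mathbb C^N$ (and the induced operator norms); $P_h:X\to\mathbb C^N$ maps a function to its values on the grid; $A_{h,0}$ is an $N\times N$ matrix (discretizing $A_0$) and $C_h:Y\to\mathbb C^N$ is linear with operator norm $\|C_h\|$, so that $A$ acting on functions with $\partial u=g$ is discretized by $A_{h,0}U_h+C_hg$. The function $f$ also makes sense as a map $[0,T]\times\mathbb C^N\to\mathbb C^N$ and $P_hf(t,u)=f(t,P_hu)$ for $t\in[0,T]$, $u\in X$. *Standing hypotheses on the discretization:* (a) $\|e^{tA_{h,0}}\|_h\le1$ for $t\ge0$; $A_{h,0}$ is invertible and $\|A_{h,0}^{-1}\|_h\le C$ with $C$ independent of $h$. (b) Let $R_h:D(A)\to\mathbb C^N$ be defined by $A_{h,0}R_hu+C_h\partial u=P_hAu$. There is a subspace $Z\subset D(A)$ with norm $\|\cdot\|_Z$ such that for $u\in Z$: $A_0^{-1}u\in Z$ and $e^{tA_0}u,f(t,u)\in Z$ for $t\in[0,T]$; $\|A_{h,0}(P_hu-R_hu)\|_h\le\varepsilon_h\|u\|_Z$ and $\|P_hu-R_hu\|_h\le\eta_h\|u\|_Z$, with $\varepsilon_h,\eta_h$ small with $h$. Moreover $\|A_{h,0}^{-1}C_h\|_h\le C''$ with $C''$ independent of $h$. (c) $f\in C^1([0,T]\times\mathbb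 C^N,\mathbb C^N)$ and its derivative with respect to the variable in $\mathbb C^N$ is uniformly bounded in a neighbourhood of the solution where the numerical approximation stays. **Classical Lawson discretization (first space, then time).** Let $a_{ij}$ ($j<i$), $b_i$, $c_i$ ($1\le i\le s$) be the coefficients of an explicit Runge–Kutta tableau. Let $k>0$ be the time stepsize, $t_n=nk$, with $t_{n+1}\le T$. The scheme is applied with one step starting from $P_hu(t_n)$: for $i=1,\dots,s$, $$\bar K_{h,i}^n=e^{c_ikA_{h,0}}P_hu(t_n)+k\sum_{j=1}^{i-1}a_{ij}e^{(c_i-c_j)kA_{h,0}}[C_hg(t_n+c_jk)+f(t_n+c_jk,\bar K^n_{h,j})],$$ $$\bar U_h^{n+1}=e^{kA_{h,0}}P_hu(t_n)+k\sum_{i=1}^sb_ie^{(1-c_i)kA_{h,0}}[C_hg(t_n+c_ik)+f(t_n+c_ik,\bar K_{h,i}^n)].$$ The local error is $\rho_{h,n+1}=\bar U_h^{n+1}-P_hu(t_{n+1})$. All $O(\cdot)$ bounds are in $\|\cdot\|_h$. *)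

(* Defs.v *)
From HB Require Import structures.
From mathcomp Require Import all_boot all_order all_algebra.
From mathcomp Require Import complex.
From mathcomp Require Import all_classical all_reals.
From mathcomp Require Import ereal topology normedtype sequences exp.

Set Implicit Arguments.
Unset Strict Implicit.
Unset Printing Implicit Defensive.

Import Order.TTheory GRing.Theory Num.Theory.
Import numFieldNormedType.Exports.

Local Open Scope classical_set_scope.
Local Open Scope ring_scope.
Local Open Scope complex_scope.

(** [R[i]^o] has a topology, [R[i]] has not; complex matrices need the latter. *)
HB.instance Definition _ (R : realType) := PseudoPointedMetric.copy R[i] R[i]^o.

(** Norms over [R[i]] take their values in [R[i]]; [nrm] is the same number
    read in [R]. *)
Definition nrm (R : realType) (V : normedModType R[i]) (v : V) : R :=
  complex.Re `|v|.

(** On ['cV[R[i]]_N] the library norm is the maximum norm, so for a square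
    matrix [M] the induced matrix norm is [opnorm (mulmx M)]. The supremum is
    meaningful for bounded [L] only. *)
Definition opnorm (R : realType) (V W : normedModType R[i]) (L : V -> W) : R :=
  sup [set nrm (L v) | v in [set v : V | nrm v <= 1]].

Definition expm (R : realType) (N : nat) (M : 'M[R[i]]_N) : 'M[R[i]]_N :=
  limn (series (fun n => (n`!%:R)^-1 *: M ^+ n)).

Record bounded_domain (R : realType) (d : nat) := BoundedDomain {
  domain_set :> set 'rV[R]_d ;
  domain_neq0 : domain_set !=set0 ;
  domain_open : open domain_set ;
  domain_connected : connected domain_set ;
  domain_bounded : bounded_set domain_set }.

Lemma continuous_linear_comb (R : realType) (T : topologicalType) (a : R[i])
    (f g : T -> R[i]^o) :
  continuous f -> continuous g -> continuous (a *: f + g : T -> R[i]^o).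
Proof.
move=> cf cg x; apply: (@cvgD R[i] R[i]^o); last exact: cg.
by apply: (@cvgZl_tmp R[i] R[i]^o); exact: cf.
Qed.

Lemma continuous_Re_norm (R : realType) (T : topologicalType) (f : T -> R[i]^o) :
  continuous f -> continuous (fun x => complex.Re `|f x| : R^o).
Proof.
move=> cf x; apply/(@cvgrPdist_lt R R^o) => e e0.
have /cvgrPdist_lt/(_ e%:C) := cf x.
rewrite ltcR => /(_ e0); apply: filterS => y fxy.
rewrite -ltcR; apply: le_lt_trans fxy.
apply: le_trans (ler_dist_dist _ _).
have := normc_ge_Re (`|f x| - `|f y|); by rewrite raddfB.
Qed.

Lemma Re_normK (R : realType) (V : normedZmodType R[i]) (x : V) :
  (complex.Re `|x|)%:C = `|x|.
Proof. by rewrite RRe_real ?normr_real. Qed.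

Lemma realcD (R : realType) (x y : R) : (x + y)%:C = x%:C + y%:C.
Proof. exact: (rmorphD (real_complex R)). Qed.

Lemma realcM (R : realType) (x y : R) : (x * y)%:C = x%:C * y%:C.
Proof. exact: (rmorphM (real_complex R)). Qed.

Section continuous_functions.
Variables (R : realType) (d : nat) (Omega : bounded_domain R d).

Local Notation K := (set_type (closure (domain_set Omega))).

Definition continuous_pred : {pred K -> R[i]^o} := [pred f | `[< continuous f >]].

Lemma continuous_predP (f : K -> R[i]^o) :
  reflect (continuous f) (f \in continuous_pred).
Proof. exact: asboolP. Qed.

Lemma continuous_submod_closed : submod_closed continuous_pred.
Proof.
split; first by apply/continuous_predP/cst_continuous.
move=> a f g /continuous_predP cf /continuous_predP cg.
by apply/continuous_predP; have := @continuous_linear_comb R K a f g cf cg.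
Qed.

HB.instance Definition _ :=
  GRing.isSubmodClosed.Build _ _ continuous_pred continuous_submod_closed.

(** The space C(closure Omega) of complex-valued continuous functions. *)
Record Cbar := CbarMk {
  Cbar_fun :> K -> R[i]^o ;
  Cbar_funP : Cbar_fun \in continuous_pred }.

HB.instance Definition _ := [isSub for Cbar_fun].
HB.instance Definition _ := [Choice of Cbar by <:].
HB.instance Definition _ := [SubChoice_isSubLmodule of Cbar by <:].

Definition max_norm (f : Cbar) : R := sup [set complex.Re `|f x| | x in setT].

Lemma bounded_set_closure : bounded_set (closure (domain_set Omega)).
Proof.
have [M [Mreal HM]] := domain_bounded Omega; exists M; split => // x Mx y cly.
have cl : closed [set z : 'rV[R]_d | `|z| <= x].
  apply: (@closed_comp _ _ (fun z : 'rV[R]_d => `|z|) [set r | r <= x]).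
    by move=> z _; exact: norm_continuous.
  exact: closed_le.
apply: (cl y); apply: closure_subset cly => z; exact: HM.
Qed.

Lemma compact_closed_domain : compact [set: K].
Proof.
have cptO : compact (closure (domain_set Omega)).
  apply: bounded_closed_compact; first exact: bounded_set_closure.
  exact: closed_closure.
move=> F PF _.
have FO : (set_val @ F) (closure (domain_set Omega)).
  suff : F (set_val @^-1` closure (domain_set Omega)) by [].
  by apply: filterE => -[y yO]; exact: set_mem yO.
have [p [Op cp]] := cptO _ _ FO.
exists (exist _ p (mem_set Op)); split=> // A B FA.
rewrite /nbhs /= => -[_ [[W oW <-] /= Wp WB]].
have [||z [[a Aa <-] Wa]] := cp (set_val @` A) W.
- suff : F (set_val @^-1` (set_val @` A)) by [].
  by apply: filterS FA => a Aa; exists a.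
- by apply: open_nbhs_nbhs; split.
by exists a; split => //; exact: WB.
Qed.

Lemma max_norm_has_ubound (f : Cbar) :
  has_ubound [set complex.Re `|f x| | x in [set: K]].
Proof.
have /compact_bounded[M [_ HM]] :
    compact ((fun x : K => complex.Re `|f x| : R^o) @` setT).
  apply: continuous_compact; last exact: compact_closed_domain.
  apply: continuous_subspaceT; apply: continuous_Re_norm.
  exact/continuous_predP/Cbar_funP.
exists (M + 1) => _ [x _ <-].
apply: le_trans (ler_norm _) _.
by apply: (HM (M + 1)); [rewrite ltrDl|exists x].
Qed.

Lemma closed_domain_neq0 : [set: K] !=set0.
Proof.
by have [x Ox] := domain_neq0 Omega; exists (exist _ x (mem_set (subset_closure Ox))).
Qed.

Lemma norm_le_max_norm (f : Cbar) (x : K) : `|f x| <= (max_norm f)%:C.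
Proof.
rewrite -[`|f x|]Re_normK lecR.
by apply: sup_upper_bound; [split; [exists (complex.Re `|f x|); exists x|
  exact: max_norm_has_ubound]|exists x].
Qed.

Lemma max_norm_le (f : Cbar) (M : R) :
  (forall x : K, `|f x| <= M%:C) -> max_norm f <= M.
Proof.
move=> fM; apply: sup_le_ub.
  by have [x _] := closed_domain_neq0; exists (complex.Re `|f x|); exists x.
by move=> _ [x _ <-]; rewrite -lecR Re_normK.
Qed.

Lemma max_norm_ge0 (f : Cbar) : 0 <= max_norm f.
Proof.
have [x _] := closed_domain_neq0.
by rewrite -ler0c; exact: le_trans (normr_ge0 (f x)) (norm_le_max_norm f x).
Qed.

Let normC (f : Cbar) : R[i] := (max_norm f)%:C.

Lemma max_normD f g : normC (f + g) <= normC f + normC g.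
Proof.
rewrite /normC -realcD lecR; apply: max_norm_le => x.
rewrite realcD; apply: le_trans (ler_normD _ _) _.
by apply: lerD; exact: norm_le_max_norm.
Qed.

Lemma max_normZ a f : normC (a *: f) = `|a| * normC f.
Proof.
pose n (b : R[i]) : R := complex.Re `|b|.
have nE b : (n b)%:C = `|b| by exact: Re_normK.
have le_Z b g : max_norm (b *: g) <= n b * max_norm g.
  apply: max_norm_le => x; rewrite realcM nE.
  rewrite [X in X <= _](_ : _ = `|b| * `|g x|) ?normrM//.
  by rewrite ler_wpM2l// norm_le_max_norm.
rewrite /normC -nE -realcM; congr _%:C; apply/eqP; rewrite eq_le le_Z/=.
have [a0|a0] := eqVneq a 0.
  by rewrite (_ : n a = 0) ?mul0r ?max_norm_ge0// /n a0 normr0.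
have a_gt0 : 0 < n a by rewrite -ltcR nE normr_gt0.
have aV : n a^-1 = (n a)^-1.
  by apply: (@complexI R); rewrite nE fmorphV/= nE normfV.
by rewrite -ler_pdivlMl// -aV -{1}[f](scalerK a0); exact: le_Z.
Qed.

Lemma max_norm_eq0 f : normC f = 0 -> f = 0.
Proof.
move=> [f0]; apply/val_inj/funext => x; apply/eqP; rewrite -normr_le0.
by have := norm_le_max_norm f x; rewrite f0.
Qed.

HB.instance Definition _ :=
  Lmodule_isNormed.Build R[i] Cbar max_normD max_normZ max_norm_eq0.

End continuous_functions.

Section calculus.
Variables (R : realType) (V W : normedModType R[i]).

Definition is_subspace (D : set V) :=
  D 0 /\ forall (a : R[i]) x y, D x -> D y -> D (a *: x + y).

Definition linear_on (D : set V) (L : V -> W) :=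
  forall (a : R[i]) x y, D x -> D y -> L (a *: x + y) = a *: L x + L y.

(** [g] is of class C^1 on [0, T] with derivative [g'], one-sided at the
    endpoints. *)
Definition is_C1_path (T : R) (g g' : R -> V) :=
  (forall t, 0 <= t <= T ->
     ((s - t)^-1)%:C *: (g s - g t) @[s --> within `[0, T] t^'] --> g' t) /\
  {within `[0, T], continuous g'}.

Definition bounded_real_linear (L : V -> W) :=
  (forall (a : R) x y, L (a%:C *: x + y) = a%:C *: L x + L y) /\
  exists M : R, forall x, nrm (L x) <= M * nrm x.

Definition strip (T : R) : set (R * V) := [set p | 0 <= p.1 <= T].

(** [f] is of class C^1 on [0, T] x V, its derivative at [(t, x)] being
    [(s, w) |-> s *: dt t x + dx t x w]. Differentiability is over the real
    numbers, the time variable being real. *)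
Definition is_C1_strip (T : R) (f dt : R -> V -> W) (dx : R -> V -> V -> W) :=
  [/\ forall p, strip T p -> bounded_real_linear (dx p.1 p.2),
      forall p, strip T p -> forall e, 0 < e ->
        \forall q \near within (strip T) (nbhs p),
          nrm (f q.1 q.2 - f p.1 p.2 - ((q.1 - p.1)%:C *: dt p.1 p.2 +
                 dx p.1 p.2 (q.2 - p.2)))
            <= e * (`|q.1 - p.1| + nrm (q.2 - p.2)),
      {within strip T, continuous (fun p => dt p.1 p.2)} &
      forall p, strip T p -> forall e, 0 < e ->
        \forall q \near within (strip T) (nbhs p),
          opnorm (fun w => dx q.1 q.2 w - dx p.1 p.2 w) <= e].

End calculus.

Section semigroups.
Variables (R : realType) (X : normedModType R[i]).

Definition C0_semigroup (S : R -> X -> X) :=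
  [/\ forall t, 0 <= t -> linear (S t) /\ continuous (S t),
      forall x, S 0 x = x,
      forall t r x, 0 <= t -> 0 <= r -> S (t + r) x = S t (S r x) &
      forall x, S t x @[t --> 0^'+] --> x].

Definition generator_of (S : R -> X -> X) (D : set X) (A : X -> X) :=
  forall x y, (D x /\ A x = y) <->
    ((t^-1)%:C *: (S t x - x) @[t --> 0^'+] --> y).

(** The type of a semigroup is its growth bound, which may be [-oo]. *)
Definition semigroup_type (S : R -> X -> X) : \bar R :=
  ereal_inf [set a%:E | a in [set a : R | exists M : R,
    forall t x, 0 <= t -> nrm (S t x) <= M * expR (a * t) * nrm x]].

End semigroups.

Section continuous_problem.
Variables (R : realType) (X Y : normedModType R[i]).

(** The value of a time-dependent function outside [0, T] and that of an
    operator outside its domain are junk. *)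
Record evolution_problem := EvolutionProblem {
  horizon : R ;
  dom : set X ;
  opA : X -> X ;
  bdry : X -> Y ;
  src : R -> X -> X ;
  bdata : R -> Y ;
  u0 : X ;
  sol : R -> X ;
  sgrp : R -> X -> X }.

Variable P : evolution_problem.
Local Notation T := (horizon P).

Definition dom0 : set X := [set x | dom P x /\ bdry P x = 0].

Definition steady_state (z : R[i]) (v : Y) (x : X) :=
  [/\ dom P x, opA P x = z *: x & bdry P x = v].

Record continuous_hypotheses : Prop := ContinuousHypotheses {
  horizon_gt0 : 0 < T ;
  dom_subspace : is_subspace (dom P) ;
  opA_linear : linear_on (dom P) (opA P) ;
  bdry_linear : linear_on (dom P) (bdry P) ;
  bdry_onto : forall v, exists2 x, dom P x & bdry P x = v ;
  bdata_C1 : exists g', is_C1_path T (bdata P) g' ;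
  dom0_dense : dense dom0 ;
  sgrp_C0 : C0_semigroup (sgrp P) ;
  sgrp_generator : generator_of (sgrp P) dom0 (opA P) ;
  sgrp_type_lt0 : (semigroup_type (sgrp P) < 0)%E ;
  steady_state_unique : forall z v, 0 < complex.Re z ->
    exists! x, steady_state z v x ;
  steady_state_bound : exists omega0 C : R,
    (semigroup_type (sgrp P) < omega0%:E)%E /\
    forall z v x, 0 < complex.Re z -> omega0 <= complex.Re z ->
      steady_state z v x -> nrm x <= C * nrm v ;
  src_C1 : exists ft fx, is_C1_strip T (src P) ft fx ;
  sol_dom : forall t, 0 <= t <= T -> dom P (sol P t) ;
  sol_A_continuous : {within `[0, T], continuous (fun t => opA P (sol P t))} ;
  sol_equation : exists2 u', is_C1_path T (sol P) u' &
    forall t, 0 <= t <= T -> u' t = opA P (sol P t) + src P t (sol P t) ;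
  sol_init : sol P 0 = u0 P ;
  sol_bdry : forall t, 0 <= t <= T -> bdry P (sol P t) = bdata P t }.

End continuous_problem.

(** Runge-Kutta coefficients; only the [rka i j] with [j < i] are used. *)
Record tableau (R : realType) (s : nat) := Tableau {
  rka : 'I_s -> 'I_s -> R ;
  rkb : 'I_s -> R ;
  rkc : 'I_s -> R }.

Section lawson.
Variables (R : realType) (s : nat) (rk : tableau R s).
Variables (N : nat) (A : 'M[R[i]]_N) (F : R -> 'cV[R[i]]_N -> 'cV[R[i]]_N).
Variables (t k : R) (v : 'cV[R[i]]_N).
Local Notation c := (rkc rk).

Definition lawson_stage_rhs (K : 'I_s -> 'cV[R[i]]_N) (i : 'I_s) : 'cV[R[i]]_N :=
  expm ((c i * k)%:C *: A) *m v +
  k%:C *: \sum_(j < s | (j < i)%N) (rka rk i j)%:C *: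
    (expm (((c i - c j) * k)%:C *: A) *m F (t + c j * k) (K j)).

(** Stage [i] depends only on the stages before it, so [i.+1] iterations of the
    defining equations from an arbitrary start yield it, see [lawson_stageE]. *)
Definition lawson_stage (i : 'I_s) : 'cV[R[i]]_N :=
  iter i.+1 lawson_stage_rhs (fun=> 0) i.

Lemma lawson_stageE (i : 'I_s) : lawson_stage i = lawson_stage_rhs lawson_stage i.
Proof.
have iterE m (j : 'I_s) : (j < m)%N ->
    iter m lawson_stage_rhs (fun=> 0) j = lawson_stage j.
  elim/ltn_ind: m j => -[//|m] IH j jm; rewrite /lawson_stage !iterS.
  congr (_ + _ *: _); apply: eq_bigr => l lj; congr (_ *: (_ *m F _ _)).
  by rewrite (IH m) ?(IH j)// (leq_trans lj).
rewrite {1}/lawson_stage iterS; congr (_ + _ *: _).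
by apply: eq_bigr => j ji; rewrite iterE.
Qed.

Definition lawson_step : 'cV[R[i]]_N :=
  expm (k%:C *: A) *m v +
  k%:C *: \sum_(i < s) (rkb rk i)%:C *:
    (expm (((1 - c i) * k)%:C *: A) *m F (t + c i * k) (lawson_stage i)).

End lawson.

Section space_discretization.
Variables (R : realType) (d : nat) (Omega : bounded_domain R d).
Variable Y : normedModType R[i].
Local Notation X := (Cbar Omega).

(** [mesh] is the set of mesh parameters for which the discretization is
    defined. *)
Record discretization := Discretization {
  mesh : set R ;
  nnodes : R -> nat ;
  node : forall h, 'I_(nnodes h) -> set_type (closure (domain_set Omega)) ;
  Ah0 : forall h, 'M[R[i]]_(nnodes h) ;
  Ch : forall h, {linear Y -> 'cV[R[i]]_(nnodes h)} ;
  Rh : forall h, X -> 'cV[R[i]]_(nnodes h) ;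
  fh : forall h, R -> 'cV[R[i]]_(nnodes h) -> 'cV[R[i]]_(nnodes h) }.

End space_discretization.

Arguments node {R d Omega Y} D h : rename.
Arguments Ah0 {R d Omega Y} D h : rename.
Arguments Ch {R d Omega Y} D h : rename.
Arguments Rh {R d Omega Y} D h : rename.
Arguments fh {R d Omega Y} D h : rename.

Section full_discretization.
Variables (R : realType) (d : nat) (Omega : bounded_domain R d).
Variable Y : normedModType R[i].
Local Notation X := (Cbar Omega).
Variables (P : evolution_problem X Y) (D : discretization Omega Y).
Variables (s : nat) (rk : tableau R s).
Local Notation T := (horizon P).
Local Notation A h := (Ah0 D h).

Definition Ph (h : R) (x : X) : 'cV[R[i]]_(nnodes D h) := \col_i x (node D h i).

Definition mxopnorm (N : nat) (M : 'M[R[i]]_N) : R :=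
  opnorm (fun v : 'cV[R[i]]_N => M *m v).

Definition forcing (h t : R) (v : 'cV[R[i]]_(nnodes D h)) :=
  Ch D h (bdata P t) + fh D h t v.

Definition Kbar (h k : R) (n : nat) : 'I_s -> 'cV[R[i]]_(nnodes D h) :=
  lawson_stage rk (A h) (@forcing h) (n%:R * k) k (Ph h (sol P (n%:R * k))).

Definition Ubar (h k : R) (n : nat) : 'cV[R[i]]_(nnodes D h) :=
  lawson_step rk (A h) (@forcing h) (n%:R * k) k (Ph h (sol P (n%:R * k))).

(** The error at time [n.+1 * k] of the step started at time [n * k]. *)
Definition local_error (h k : R) (n : nat) : 'cV[R[i]]_(nnodes D h) :=
  Ubar h k n - Ph h (sol P (n.+1%:R * k)).

Definition regular_subspace (Z : set X) (normZ : X -> R) :=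
  [/\ is_subspace Z, Z `<=` dom P,
      [/\ forall x, Z x -> 0 <= normZ x,
          forall x, Z x -> normZ x = 0 -> x = 0,
          forall a x, Z x -> normZ (a *: x) = nrm (a : R[i]^o) * normZ x &
          forall x y, Z x -> Z y -> normZ (x + y) <= normZ x + normZ y],
      forall x, Z x -> exists y, [/\ Z y, bdry P y = 0 & opA P y = x] &
      forall t x, 0 <= t <= T -> Z x -> Z (sgrp P t x) /\ Z (src P t x)].

Record discretization_hypotheses : Prop := DiscretizationHypotheses {
  mesh_gt0 : forall h, mesh D h -> 0 < h ;
  node_inj : forall h, mesh D h -> injective (node D h) ;
  Ch_continuous : forall h, mesh D h ->
    continuous (Ch D h : Y -> 'cV[R[i]]_(nnodes D h)) ;
  fhP : forall h t x, mesh D h -> 0 <= t <= T ->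
    Ph h (src P t x) = fh D h t (Ph h x) ;
  Ah0_contractive : forall h t, mesh D h -> 0 <= t ->
    mxopnorm (expm (t%:C *: A h)) <= 1 ;
  Ah0_unit : forall h, mesh D h -> A h \in unitmx ;
  Ah0_inv_bounded : exists C : R, forall h, mesh D h ->
    mxopnorm (invmx (A h)) <= C ;
  RhP : forall h x, mesh D h -> dom P x ->
    A h *m Rh D h x + Ch D h (bdry P x) = Ph h (opA P x) ;
  Rh_consistent : exists (Z : set X) (normZ : X -> R) (eps eta : R -> R),
    [/\ regular_subspace Z normZ,
        eps h @[h --> within (mesh D) (nbhs 0)] --> 0,
        eta h @[h --> within (mesh D) (nbhs 0)] --> 0 &
        forall h x, mesh D h -> Z x ->
          nrm (A h *m (Ph h x - Rh D h x)) <= eps h * normZ x /\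
          nrm (Ph h x - Rh D h x) <= eta h * normZ x] ;
  Ah0_inv_Ch_bounded : exists C : R, forall h, mesh D h ->
    opnorm (fun y => invmx (A h) *m Ch D h y) <= C ;
  (* The neighbourhood of the solution is a tube whose radius [r h] may depend
     on [h]; it has to contain the internal stages, where [fh] is evaluated. *)
  fh_C1 : exists (ft : forall h, R -> 'cV[R[i]]_(nnodes D h) ->
                        'cV[R[i]]_(nnodes D h))
                 (fv : forall h, R -> 'cV[R[i]]_(nnodes D h) ->
                        'cV[R[i]]_(nnodes D h) -> 'cV[R[i]]_(nnodes D h))
                 (r : R -> R) (L : R),
    forall h, mesh D h ->
      [/\ is_C1_strip T (fh D h) (ft h) (fv h), 0 < r h,
          forall t v, 0 <= t <= T -> nrm (v - Ph h (sol P t)) < r h ->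
            opnorm (fv h t v) <= L &
          forall k n i, 0 < k -> n.+1%:R * k <= T ->
            nrm (Kbar h k n i - Ph h (sol P (n%:R * k + rkc rk i * k))) < r h] }.

End full_discretization.

(* Main.v *)
(** Multiplying by [A^-1], with [A = A_{h,0}], tames the unbounded boundary operator,
    since [A^-1 C_h] is bounded. A summand [k e^(tau A) C_h g] of the stage [i],
    where [tau = (c_i - c_j) k > 0], equals
    [(c_i - c_j)^-1 (tau A e^(tau A)) (A^-1 C_h) g], so the stages are bounded
    uniformly in [h] and [k], and so is [f] along them. Only the final sum, where
    [1 - c_i] may vanish, leaves a term [k C_h g] in the error; after applying
    [A^-1] it is [O(k)], and so are [A^-1 (e^(k A) - 1) v], the integral of
    [e^(s A) v] over [0, k], and [A^-1] applied to [P_h (u(t_n) - u(t_{n+1}))]. *)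

Require Import Defs.
From HB Require Import structures.
From mathcomp Require Import all_boot all_order all_algebra.
From mathcomp Require Import ring lra complex.
From mathcomp Require Import all_classical all_reals.
From mathcomp Require Import ereal topology normedtype sequences exp.

Set Implicit Arguments.
Unset Strict Implicit.
Unset Printing Implicit Defensive.

Import Order.TTheory GRing.Theory Num.Theory.
Import numFieldNormedType.Exports.

Local Open Scope classical_set_scope.
Local Open Scope ring_scope.
Local Open Scope complex_scope.

(** * Real-valued norms over the complex field *)

Section nrm_theory.
Variables (R : realType) (V : normedModType R[i]).
Implicit Types (x y : V) (a : R).

Lemma nrmE x : (nrm x)%:C = `|x|.
Proof. exact: Re_normK. Qed.

Lemma nrm_le x a : (nrm x <= a) = (`|x| <= a%:C).
Proof. by rewrite -nrmE lecR. Qed.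

Lemma nrm_ge0 x : 0 <= nrm x.
Proof. by rewrite -lecR nrmE normr_ge0. Qed.

Lemma nrm0 : nrm (0 : V) = 0.
Proof. by rewrite /nrm normr0. Qed.

Lemma nrmN x : nrm (- x) = nrm x.
Proof. by rewrite /nrm normrN. Qed.

Lemma nrmB x y : nrm (x - y) = nrm (y - x).
Proof. by rewrite -nrmN opprB. Qed.

Lemma nrmD x y : nrm (x + y) <= nrm x + nrm y.
Proof. by rewrite nrm_le realcD !nrmE ler_normD. Qed.

Lemma nrmBD x y : nrm (x - y) <= nrm x + nrm y.
Proof. by rewrite -(nrmN y) nrmD. Qed.

Lemma nrmZ a x : nrm (a%:C *: x) = `|a| * nrm x.
Proof.
by apply: complexI; rewrite realcM !nrmE normrZ normc_def /= expr0n addr0 sqrtr_sqr.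
Qed.

Lemma nrm_eq0 x : nrm x = 0 -> x = 0.
Proof. by move=> x0; apply/normr0_eq0; rewrite -nrmE x0. Qed.

Lemma nrm_dist x y : `|nrm x - nrm y| <= nrm (x - y).
Proof.
have le_sub (u v : V) : nrm u - nrm v <= nrm (u - v).
  by rewrite lerBlDr -{1}(subrK v u) nrmD.
by rewrite ler_norml lerNl opprB le_sub nrmB le_sub.
Qed.

Lemma nrm_sum (I : finType) (p : pred I) (F : I -> V) :
  nrm (\sum_(i | p i) F i) <= \sum_(i | p i) nrm (F i).
Proof.
elim/big_ind2: _ => [|u a v b ua vb|//]; first by rewrite nrm0.
by rewrite (le_trans (nrmD _ _))// lerD.
Qed.

Lemma cvg_nrm (T : Type) (F : set_system T) {FF : Filter F} (f : T -> V) y :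
  f t @[t --> F] --> y <->
  forall e, 0 < e -> \forall t \near F, nrm (f t - y) <= e.
Proof.
split=> [/cvgrPdist_le fy e e0|fy].
  have := fy e%:C; rewrite ltcR => /(_ e0); apply: filterS => t.
  by rewrite -nrmE lecR nrmB.
apply/cvgrPdist_le => e e0.
(* A positive element of [R[i]] is real, so real tolerances exhaust all of them. *)
have eE : e = (complex.Re e)%:C by rewrite RRe_real// gtr0_real.
have := fy (complex.Re e); rewrite -ltcR -eE => /(_ e0); apply: filterS => t.
by rewrite nrmB nrm_le -eE.
Qed.

End nrm_theory.

(** * Boundedness on compact intervals and the mean value inequality *)

Lemma continuous_within_bounded (R : realType) (V : normedModType R[i])
    (f : R -> V) (a b : R) :
  {within `[a, b], continuous f} ->
  exists M, forall t, a <= t <= b -> nrm (f t) <= M.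
Proof.
move=> cf.
have cn : {within `[a, b], continuous (fun t => nrm (f t) : R^o)}.
  move=> t; apply/(@cvgrPdist_le R R^o) => e e0.
  have /cvg_nrm/(_ e e0) := cf t; apply: filterS => s fs.
  by apply: le_trans (nrm_dist _ _) _; rewrite nrmB.
have [M [_ HM]] := compact_bounded (continuous_compact cn (segment_compact (a := a) (b := b))).
exists (M + 1) => t tab; apply: le_trans (ler_norm _) _.
apply: (HM (M + 1)); first by rewrite ltrDl.
by exists t => //=; rewrite in_itv.
Qed.

Section mean_value.
Variables (R : realType) (V : normedModType R[i]).
Implicit Types (f : R -> V).

(** Supremum argument: the set [S] of points up to which the bound holds contains its supremum, by
    the local estimate to the left of it, and the local estimate to the right excludes a supremum
    below [b]. *)
Lemma local_lipschitz_mean_value f (a b B : R) : a <= b ->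
  (forall s, a <= s <= b ->
    \forall r \near within `[a, b] (nbhs s), nrm (f r - f s) <= B * `|r - s|) ->
  nrm (f b - f a) <= B * (b - a).
Proof.
move=> ab locf.
pose S := [set x | a <= x <= b /\ nrm (f x - f a) <= B * (x - a)].
have Sa : S a by split; rewrite ?lexx ?ab// !subrr nrm0 mulr0.
have hsS : has_sup S by split; [exists a|exists b => x [/andP[]]].
have step x y : S x -> a <= y <= b -> x <= y ->
    nrm (f y - f x) <= B * (y - x) -> S y.
  move=> [_ fx] yab xy fxy; split => //.
  have -> : f y - f a = (f y - f x) + (f x - f a) by rewrite addrA subrK.
  apply: le_trans (nrmD _ _) _; apply: le_trans (lerD fxy fx) _.
  by rewrite -mulrDr addrA subrK.
have cab : a <= sup S <= b.
  rewrite (sup_upper_bound hsS)//=; apply: ge_sup; first by exists a.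
  by move=> x [/andP[]].
have /nbhs_ballP[/= d d0 dS] := locf _ cab.
have Sc : S (sup S).
  have [x Sx cx] := sup_adherent d0 hsS.
  have xc : x <= sup S by exact: sup_upper_bound.
  apply: (step x) => //; have := dS x.
  rewrite /ball /= ger0_norm ?subr_ge0// ltrBlDl -ltrBlDr => /(_ cx).
  rewrite in_itv /= nrmB distrC (ger0_norm (_ : 0 <= sup S - x)) ?subr_ge0//.
  by apply; case: Sx.
suff <- : sup S = b by case: Sc.
apply/eqP; rewrite eq_le; case/andP: (cab) => _ -> /=; rewrite leNgt.
apply/negP => cb.
(* A point beyond the supremum, inside both the interval and the ball of radius [d]. *)
pose y := Num.min b (sup S + d / 2).
have cy : sup S < y by rewrite lt_min cb ltrDl divr_gt0.
have Sy : S y.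
  apply: (step (sup S)) => //; last 1 first.
  - have := dS y; rewrite /ball /= distrC gtr0_norm ?subr_gt0// => ->//.
    + rewrite ltrBlDl; apply: (@le_lt_trans _ _ (sup S + d / 2)).
        by rewrite ge_min lexx orbT.
      by rewrite ltrD2l ltr_pdivrMr// ltr_pMr// ltr1n.
    + by rewrite in_itv /= ge_min lexx andbT (le_trans _ (ltW cy)) //; case/andP: cab.
  - by rewrite ge_min lexx andbT (le_trans _ (ltW cy)) //; case/andP: cab.
  - exact: ltW.
by have := sup_upper_bound hsS Sy; rewrite leNgt cy.
Qed.

(** Slope [M + e] near each point, for arbitrary [e], is what a derivative of norm at most [M]
    provides. *)
Lemma derivative_mean_value f (a b M : R) : a <= b ->
  (forall s e, a <= s <= b -> 0 < e ->
    \forall r \near within `[a, b] (nbhs s), nrm (f r - f s) <= (M + e) * `|r - s|) ->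
  nrm (f b - f a) <= M * (b - a).
Proof.
move=> ab locf; apply/ler_addgt0Pr => e e0.
(* This slack adds at most [e] over the whole interval; the [+ 1] covers [a = b]. *)
have d0 : 0 < e / (b - a + 1).
  by rewrite divr_gt0// ltr_wpDl// subr_ge0.
apply: le_trans (local_lipschitz_mean_value ab (fun s sab => locf s _ sab d0)) _.
rewrite mulrDl lerD2l mulrAC ler_pdivrMr ?ltr_wpDl ?subr_ge0//.
by rewrite ler_pM2l// lerDl.
Qed.

(** The derivative is bounded, being continuous on a compact interval, and its bound serves as the
    Lipschitz constant. *)
Lemma C1_path_lipschitz (T : R) (g g' : R -> V) : is_C1_path T g g' ->
  exists M, forall a b, 0 <= a -> a <= b -> b <= T ->
    nrm (g b - g a) <= M * (b - a).
Proof.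
move=> [dg /continuous_within_bounded[M gM]]; exists M => a b a0 ab bT.
apply: derivative_mean_value => // s e /andP[as_ sb] e0.
have sT : 0 <= s <= T by rewrite (le_trans a0) ?(le_trans sb).
have /cvg_nrm/(_ _ e0) := dg s sT.
rewrite /dnbhs !near_withinE; apply: filterS => r Hr; rewrite /= in_itv /= => /andP[ar rb].
(* The difference quotient says nothing at [r = s], where the estimate is trivial. *)
have [->|rs] := eqVneq r s; first by rewrite !subrr nrm0 normr0 mulr0.
have rT : 0 <= r <= T by rewrite (le_trans a0) ?(le_trans rb).
have {}Hr : nrm (((r - s)^-1)%:C *: (g r - g s) - g' s) <= e.
  by apply: Hr; rewrite /= ?in_itv//.
have rs0 : 0 < `|r - s| by rewrite normr_gt0 subr_eq0.
rewrite -ler_pdivrMr// mulrC -normfV -nrmZ.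
rewrite -(subrK (g' s) (_ *: _)); apply: le_trans (nrmD _ _) _.
by rewrite addrC lerD// gM.
Qed.

Lemma C1_path_bounded (T : R) (g g' : R -> V) : 0 <= T -> is_C1_path T g g' ->
  exists M, forall t, 0 <= t <= T -> nrm (g t) <= M.
Proof.
move=> T0 /C1_path_lipschitz[M gM]; exists (`|M| * T + nrm (g 0)) => t /andP[t0 tT].
rewrite -(subrK (g 0) (g t)); apply: le_trans (nrmD _ _) _; rewrite lerD2r.
apply: le_trans (gM 0 t _ _ _) _ => //; rewrite subr0.
by apply: le_trans (ler_wpM2r t0 (ler_norm M)) _; rewrite ler_wpM2l.
Qed.

End mean_value.

(** * Operator norms of bounded real-linear maps *)

Section opnorm_theory.
Variables (R : realType) (V W : normedModType R[i]).

Lemma bounded_real_linear0 (L : V -> W) : bounded_real_linear L -> L 0 = 0.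
Proof.
move=> [linL _]; have := linL 1 0 0; rewrite scale1r addr0 scale1r => /eqP.
by rewrite -subr_eq subrr => /eqP.
Qed.

Lemma opnorm_has_sup (L : V -> W) : bounded_real_linear L ->
  has_sup [set nrm (L v) | v in [set v : V | nrm v <= 1]].
Proof.
move=> [_ [M LM]]; split; first by exists (nrm (L 0)); exists 0; rewrite /= ?nrm0.
exists `|M| => _ [v /= v1 <-]; apply: le_trans (LM v) _.
apply: le_trans (ler_wpM2r (nrm_ge0 v) (ler_norm M)) _.
by rewrite -[leRHS]mulr1 ler_wpM2l.
Qed.

Lemma opnorm_ge0 (L : V -> W) : bounded_real_linear L -> 0 <= opnorm L.
Proof.
move=> Lb; apply: sup_upper_bound; first exact: opnorm_has_sup.
by exists 0; rewrite /= ?bounded_real_linear0 ?nrm0.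
Qed.

(** Rescaling [v] to norm 1 uses a real factor only, so real linearity suffices; the derivatives in
    [is_C1_strip] are assumed no more than real-linear. *)
Lemma le_opnorm (L : V -> W) v :
  bounded_real_linear L -> nrm (L v) <= opnorm L * nrm v.
Proof.
move=> Lb; have L0 := bounded_real_linear0 Lb.
have LZ (a : R) x : L (a%:C *: x) = a%:C *: L x.
  by case: Lb => linL _; have := linL a x 0; rewrite L0 !addr0.
have [/nrm_eq0->|v0] := eqVneq (nrm v) 0; first by rewrite L0 !nrm0 mulr0.
have v_gt0 : 0 < nrm v by rewrite lt_neqAle eq_sym v0 nrm_ge0.
rewrite -ler_pdivrMr// mulrC -(ger0_norm (_ : 0 <= (nrm v)^-1)) ?invr_ge0 ?nrm_ge0//.
rewrite -nrmZ -LZ; apply: sup_upper_bound; first exact: opnorm_has_sup.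
exists ((nrm v)^-1%:C *: v) => //=.
by rewrite nrmZ ger0_norm ?invr_ge0 ?nrm_ge0// mulVf.
Qed.

Lemma le_opnormW (L : V -> W) (M : R) v : bounded_real_linear L ->
  opnorm L <= M -> nrm (L v) <= M * nrm v.
Proof.
by move=> Lb LM; apply: le_trans (le_opnorm v Lb) _; rewrite ler_wpM2r ?nrm_ge0.
Qed.

Lemma continuous_linear_bounded (L : {linear V -> W}) :
  continuous L -> bounded_real_linear L.
Proof.
move=> cL; split; first by move=> a x y; rewrite linearP.
have /cvg_nrm/(_ 1 ltr01) := cL 0; rewrite linear0.
move=> /nbhs_normP[/= d d0 dL].
have dE : d = (complex.Re d)%:C by rewrite RRe_real// gtr0_real.
set r := complex.Re d in dE.
have r0 : 0 < r by rewrite -ltcR -dE.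
exists (2 / r) => x.
have [/nrm_eq0->|v0] := eqVneq (nrm x) 0; first by rewrite linear0 !nrm0 mulr0.
have x_gt0 : 0 < nrm x by rewrite lt_neqAle eq_sym v0 nrm_ge0.
(* [a%:C *: x] has norm [r / 2], inside the ball that [L] maps into the unit ball; hence the
   constant [2 / r]. *)
pose a := r / (2 * nrm x).
have a0 : 0 < a by rewrite divr_gt0 ?mulr_gt0.
have : nrm (a%:C *: x) < r -> nrm (L (a%:C *: x)) <= 1.
  move=> axr; rewrite -[L _]subr0; apply: (dL (a%:C *: x)).
  by rewrite /= sub0r normrN -nrmE dE ltcR.
rewrite linearZ !nrmZ gtr0_norm//.
have -> : a * nrm x = r / 2.
  by rewrite /a invfM mulrA mulfVK.
rewrite ltr_pdivrMr// ltr_pMr// ltr1n => /(_ isT).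
rewrite mulrC -ler_pdivlMr// mul1r /a invf_div => h.
by rewrite mulrAC.
Qed.

End opnorm_theory.

(** Mean value inequality along the segment from [v] to [w], which stays in the ball around [v]
    where the derivative is bounded by [L]. *)
Lemma C1_strip_lipschitz (R : realType) (V W : normedModType R[i]) (T : R)
    (f dt : R -> V -> W) (dx : R -> V -> V -> W) (t r L : R) (v w : V) :
  is_C1_strip T f dt dx -> 0 <= t <= T ->
  (forall x, nrm (x - v) < r -> opnorm (dx t x) <= L) ->
  nrm (w - v) < r -> nrm (f t w - f t v) <= L * nrm (w - v).
Proof.
move=> [dxb df _ _] tT dxL wr.
pose p s := v + s%:C *: (w - v).
have pB s s' : p s' - p s = (s' - s)%:C *: (w - v).
  by rewrite /p opprD addrACA subrr add0r -scalerBl -rmorphB.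
have := @derivative_mean_value R W (fun s => f t (p s)) 0 1 (L * nrm (w - v)) ler01.
rewrite /p scale0r addr0 scale1r subr0 mulr1 (addrC v) subrK; apply.
move=> s e /andP[s0 s1] e0.
have tube : nrm (p s - v) < r.
  rewrite /p addrC addKr nrmZ ger0_norm//.
  by apply: le_lt_trans wr; rewrite ler_piMl ?nrm_ge0.
have st : strip T (t, p s) by [].
(* Scaled so that the remainder [e' * |s' - s| * nrm (w - v)] is at most [e * |s' - s|]. *)
pose e' := e / (nrm (w - v) + 1).
have n1 : 0 < nrm (w - v) + 1 by rewrite ltr_wpDl ?nrm_ge0.
have e'0 : 0 < e' by rewrite divr_gt0.
have /= := df _ st _ e'0.
have cpV : p s' @[s' --> s] --> p s.
  apply/cvg_nrm => a a0; near=> s'.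
  rewrite pB nrmZ; apply: (@le_trans _ _ (a / (nrm (w - v) + 1) * nrm (w - v))).
    rewrite ler_wpM2r ?nrm_ge0// distrC; near: s'.
    by apply: (@cvgr_dist_le R R^o); [exact: cvg_id|rewrite divr_gt0].
  by rewrite mulrAC ler_pdivrMr// ler_pM2l// lerDl.
have cp : (t, p s') @[s' --> s] --> (t, p s).
  exact: (cvg_pair (cvg_cst t) cpV).
rewrite near_withinE => /cp.
rewrite near_withinE; apply: (@filterS _ (nbhs s)) => s' H _.
have {H} := H tT; rewrite subrr normr0 add0r rmorph0 scale0r add0r pB => H.
rewrite -(subrK (dx t (p s) ((s' - s)%:C *: (w - v))) (_ - _)).
apply: le_trans (nrmD _ _) _; apply: le_trans (lerD H (le_opnormW _ (dxb _ st) (dxL _ tube))) _.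
rewrite nrmZ mulrDl addrC lerD//; first by rewrite mulrCA mulrC.
rewrite mulrCA mulrC ler_wpM2r//.
by rewrite /e' mulrAC ler_pdivrMr// ler_pM2l// lerDl.
Unshelve. all: by end_near.
Qed.

(** * The entrywise maximum norm and convergence of matrix series *)

Section matrix_norm.
Variable R : realType.

Lemma nrm_entry_le m n (M : 'M[R[i]]_(m, n)) i j : nrm (M i j : R[i]^o) <= nrm M.
Proof.
rewrite nrm_le nrmE [leRHS]/Num.Def.normr /= mx_normE -[leLHS]nngE num_le.
exact: (le_bigmax _ _ (i, j)).
Qed.

Lemma nrm_mx_le m n (M : 'M[R[i]]_(m, n)) (b : R) : 0 <= b ->
  (forall i j, nrm (M i j : R[i]^o) <= b) -> nrm M <= b.
Proof.
move=> b0 Mb; rewrite nrm_le [leLHS]/Num.Def.normr /= mx_normE.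
have bC : 0 <= b%:C by rewrite ler0c.
rewrite -[b%:C]/((NngNum bC)%:num) num_le; apply/bigmax_leP; split=> [|ij _].
  by rewrite -num_le.
by rewrite -num_le /=; have := Mb ij.1 ij.2; rewrite nrm_le.
Qed.

(** The norm of a matrix is its largest entry modulus, not the induced norm; hence the factor
    [n]. *)
Lemma nrm_mulmx m n p (A : 'M[R[i]]_(m, n)) (B : 'M[R[i]]_(n, p)) :
  nrm (A *m B) <= n%:R * nrm A * nrm B.
Proof.
apply: nrm_mx_le => [|i j]; first by rewrite !mulr_ge0 ?nrm_ge0.
rewrite mxE; apply: le_trans (nrm_sum _ _) _.
apply: (@le_trans _ _ (\sum_(l < n) nrm A * nrm B)); last first.
  by rewrite sumr_const card_ord -[leLHS]mulr_natl mulrA.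
apply: ler_sum => l _; rewrite nrm_le realcM [leLHS]normrM.
by apply: ler_pM => //;
  [have := nrm_entry_le A i l|have := nrm_entry_le B l j]; rewrite nrm_le.
Qed.

Lemma nrm_mx1 n : nrm (1%:M : 'M[R[i]]_n) <= 1.
Proof.
apply: nrm_mx_le => // i j; rewrite nrm_le mxE.
by case: (i == j); rewrite ?normr1 ?normr0.
Qed.

Lemma mulmx_bounded m n p (A : 'M[R[i]]_(m, n)) :
  bounded_real_linear (fun v : 'M[R[i]]_(n, p) => A *m v).
Proof.
split; first by move=> a x y; rewrite mulmxDr -scalemxAr.
by exists (n%:R * nrm A) => x; exact: nrm_mulmx.
Qed.

Lemma le_mxopnorm N (M : 'M[R[i]]_N) (b : R) (v : 'cV[R[i]]_N) :
  mxopnorm M <= b -> nrm (M *m v) <= b * nrm v.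
Proof. by move=> Mb; apply: le_opnormW => //; exact: mulmx_bounded. Qed.

Lemma cvg_mulmxl m n p (F : set_system nat) {FF : Filter F} (A : 'M[R[i]]_(m, n))
    (f : nat -> 'M[R[i]]_(n, p)) (l : 'M[R[i]]_(n, p)) :
  f q @[q --> F] --> l -> A *m f q @[q --> F] --> A *m l.
Proof.
move=> /cvg_nrm fl; apply/cvg_nrm => e e0.
have c0 : 0 < n%:R * nrm A + 1 by rewrite ltr_wpDl ?mulr_ge0 ?nrm_ge0.
apply: filterS (fl _ (divr_gt0 e0 c0)) => q Hq; rewrite -mulmxBr.
apply: le_trans (nrm_mulmx _ _) _.
apply: le_trans (_ : _ <= (n%:R * nrm A + 1) * nrm (f q - l)) _.
  by rewrite ler_wpM2r ?nrm_ge0// lerDl.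
by rewrite mulrC -ler_pdivlMr.
Qed.

Lemma cvg_mulmxr m n p (F : set_system nat) {FF : Filter F} (A : 'M[R[i]]_(n, p))
    (f : nat -> 'M[R[i]]_(m, n)) (l : 'M[R[i]]_(m, n)) :
  f q @[q --> F] --> l -> f q *m A @[q --> F] --> l *m A.
Proof.
move=> /cvg_nrm fl; apply/cvg_nrm => e e0.
have c0 : 0 < n%:R * nrm A + 1 by rewrite ltr_wpDl ?mulr_ge0 ?nrm_ge0.
apply: filterS (fl _ (divr_gt0 e0 c0)) => q Hq; rewrite -mulmxBl.
apply: le_trans (nrm_mulmx _ _) _; rewrite mulrAC.
apply: le_trans (_ : _ <= (n%:R * nrm A + 1) * nrm (f q - l)) _.
  by rewrite ler_wpM2r ?nrm_ge0// lerDl.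
by rewrite mulrC -ler_pdivlMr.
Qed.

Lemma cvg_nrm_le (V : normedModType R[i]) (f : nat -> V) (l : V) (b : R) :
  f q @[q --> \oo] --> l -> (forall q, nrm (f q) <= b) -> nrm l <= b.
Proof.
move=> /cvg_nrm fl fb; apply/ler_addgt0Pr => e /fl [q _ /(_ q (leqnn q)) /= Hq].
rewrite -(subrK (f q) l) addrC; apply: le_trans (nrmD _ _) _.
by rewrite lerD// nrmB.
Qed.

Lemma nrm_complex_le (z : R[i]) :
  nrm (z : R[i]^o) <= `|complex.Re z| + `|complex.Im z|.
Proof.
rewrite nrm_le realcD [z in leLHS]complexE; apply: le_trans (ler_normD _ _) _.
rewrite normrM !normc_def /= !expr0n !addr0 add0r expr1n sqrtr1 mul1r.
by rewrite !sqrtr_sqr.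
Qed.

Lemma Re_le_nrm (z : R[i]) : `|complex.Re z| <= nrm (z : R[i]^o).
Proof. by rewrite -lecR nrmE; exact: normc_ge_Re. Qed.

Lemma Im_le_nrm (z : R[i]) : `|complex.Im z| <= nrm (z : R[i]^o).
Proof.
rewrite -lecR nrmE normc_def lecR -sqrtr_sqr ler_wsqrtr//.
by rewrite lerDr sqr_ge0.
Qed.

(** Real and imaginary parts of each entry are dominated by [b], so the comparison test for real
    series gives the limit entry by entry. *)
Lemma dominated_mx_series_cvg m n (w : nat -> 'M[R[i]]_(m, n)) (b : nat -> R) :
  (forall q, nrm (w q) <= b q) -> cvgn (series b) ->
  exists l : 'M[R[i]]_(m, n), series w q @[q --> \oo] --> l.
Proof.
move=> wb cb.
have b0 q : 0 <= b q by exact: le_trans (nrm_ge0 _) (wb q).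
have cvg_part (g : {additive R[i] -> R}) i j :
    (forall z, `|g z| <= nrm (z : R[i]^o)) ->
    g (series w q i j) @[q --> \oo] --> limn (series (fun q => g (w q i j))).
  move=> gle.
  have -> : (fun q => g (series w q i j)) = series (fun q => g (w q i j)).
    by apply/funext => q; rewrite /series /= summxE raddf_sum.
  apply: (@normed_cvg _ R^o); apply: (series_le_cvg _ _ _ cb) => [q|//|q]; first exact: normr_ge0.
  by apply: le_trans (gle _) _; apply: le_trans (nrm_entry_le _ _ _) (wb q).
pose l := \matrix_(i, j) (limn (series (fun q => complex.Re (w q i j))) +i*
                          limn (series (fun q => complex.Im (w q i j)))).
exists l; apply/cvg_nrm => e e0.
have e2 : 0 < e / 2 by rewrite divr_gt0.
(* There are finitely many entries, so one threshold serves all of them. *)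
have : \forall q \near \oo, forall ij : 'I_m * 'I_n,
    nrm ((series w q - l) ij.1 ij.2 : R[i]^o) <= e.
  apply: filter_forall => -[i j] /=.
  have /cvgrPdist_le/(_ _ e2) := cvg_part (@complex.Re R) i j Re_le_nrm.
  have /cvgrPdist_le/(_ _ e2) := cvg_part (@complex.Im R) i j Im_le_nrm.
  apply: filterS2 => q Hi Hr; apply: le_trans (nrm_complex_le _) _.
  rewrite !mxE !raddfB /= [leRHS]splitr.
  by rewrite lerD// distrC.
apply: filterS => q H; apply: nrm_mx_le => [|i j]; first exact: ltW.
exact: (H (i, j)).
Qed.

End matrix_norm.

(** * The matrix exponential and its first-order expansion *)

Section matrix_exponential.
Variables (R : realType) (N : nat) (A : 'M[R[i]]_N).
Implicit Types (x y : R).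

(** Its powers bound those of [A], so the series of [expm (x%:C *: A)] is dominated by the real
    exponential series at [|x| * a]. *)
Let a : R := N%:R * nrm A + 1.

Let a_ge1 : 1 <= a.
Proof. by rewrite lerDr mulr_ge0 ?nrm_ge0. Qed.

Lemma nrm_expr n : nrm (A ^+ n) <= a ^+ n.
Proof.
elim: n => [|n IH]; first by rewrite !expr0; exact: nrm_mx1.
rewrite !exprS; apply: le_trans (nrm_mulmx _ _) _.
by rewrite ler_pM ?mulr_ge0 ?nrm_ge0// lerDl.
Qed.

Lemma expm_termE x n :
  (n`!%:R)^-1 *: (x%:C *: A) ^+ n = (exp_coeff x n)%:C *: A ^+ n.
Proof.
have -> : (x%:C *: A) ^+ n = (x ^+ n)%:C *: A ^+ n.
  elim: n => [|n IH]; first by rewrite !expr0 scale1r.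
  rewrite !exprS IH realcM -[LHS]/((x%:C *: A) *m (_ *: _)).
  by rewrite -scalemxAl -scalemxAr scalerA.
by rewrite scalerA exp_coeffE realcM fmorphV rmorph_nat.
Qed.

Definition expm_partial x q : 'M[R[i]]_N :=
  series (fun n => (exp_coeff x n)%:C *: A ^+ n) q.

Lemma expm_partial_cvg x :
  expm_partial x q @[q --> \oo] --> expm (x%:C *: A).
Proof.
have wb n : nrm ((exp_coeff x n)%:C *: A ^+ n) <= exp_coeff (`|x| * a) n.
  rewrite nrmZ !exp_coeffE exprMn normrM normfV normrX normr_nat mulrA.
  by rewrite ler_wpM2l ?mulr_ge0 ?exprn_ge0 ?nrm_expr.
have [l xl] := dominated_mx_series_cvg wb (is_cvg_series_exp_coeff _).
have -> : expm (x%:C *: A) = l; last exact: xl.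
rewrite /expm; apply: cvg_lim; first exact: norm_hausdorff.
by under eq_fun do rewrite expm_termE.
Qed.

(** The partial sums are polynomials in [A], hence commute with it; both sides are limits of the
    same sequence. *)
Lemma expm_comm x : A *m expm (x%:C *: A) = expm (x%:C *: A) *m A.
Proof.
have comm q : A *m expm_partial x q = expm_partial x q *m A.
  rewrite mulmx_sumr mulmx_suml; apply: eq_bigr => n _.
  by rewrite -scalemxAr -scalemxAl; congr (_ *: _); exact: commrX.
have cl : expm_partial x q *m A @[q --> \oo] --> A *m expm (x%:C *: A).
  under eq_fun do rewrite -comm; exact: cvg_mulmxl (expm_partial_cvg (x := x)).
have cr : expm_partial x q *m A @[q --> \oo] --> expm (x%:C *: A) *m A.
  exact: cvg_mulmxr (expm_partial_cvg (x := x)).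
exact: (cvg_unique (@norm_hausdorff _ _) cl cr).
Qed.

Lemma expm0 : expm (0%:C *: A) = 1%:M.
Proof.
suff c1 : expm_partial 0 q @[q --> \oo] --> (1%:M : 'M[R[i]]_N).
  exact: (cvg_unique (@norm_hausdorff _ _) (expm_partial_cvg (x := 0)) c1).
apply/cvg_nrm => e e0.
(* For [q = 0] the partial sum is empty and differs from the identity. *)
near=> q; have [p ->] : exists p, q = p.+1.
  by exists q.-1; rewrite prednK//; near: q; exists 1%N.
rewrite /expm_partial /series /= big_mkord big_ord_recl big1 => [|n _].
  by rewrite exp_coeffE fact0 !expr0 invr1 mulr1 rmorph1 scale1r addr0 subrr nrm0 ltW.
by rewrite exp_coeffE exprS mul0r mulr0 rmorph0 scale0r.
Unshelve. all: by end_near.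
Qed.

(** The remainder [D n := x ^+ n - y ^+ n - (x - y) * n * y ^+ n.-1] satisfies
    [D n.+1 = x * D n + (x - y) ^+ 2 * n * y ^+ n.-1]. *)
Lemma taylor_expr_le x y r n : 1 <= r -> `|x| <= r -> `|y| <= r ->
  `|x ^+ n - y ^+ n - (x - y) * (n%:R * y ^+ n.-1)|
    <= (x - y) ^+ 2 * (2 * r) ^+ n.
Proof.
move=> r1 xr yr.
have r0 : 0 <= r by exact: le_trans r1.
elim: n => [|n IH]; first by rewrite !expr0 subrr mul0r mulr0 subr0 normr0 mulr1 sqr_ge0.
have -> : x ^+ n.+1 - y ^+ n.+1 - (x - y) * (n.+1%:R * y ^+ n) =
    x * (x ^+ n - y ^+ n - (x - y) * (n%:R * y ^+ n.-1)) +
    (x - y) ^+ 2 * (n%:R * y ^+ n.-1).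
  case: n {IH} => [|n]; first by rewrite /=; ring.
  by rewrite /= !exprS -[n.+2%:R]natr1; ring.
apply: le_trans (ler_normD _ _) _; rewrite !normrM.
have -> : (2 * r) ^+ n.+1 = r * (2 * r) ^+ n + r * (2 * r) ^+ n.
  by rewrite exprS; ring.
rewrite mulrDr; apply: lerD.
  by rewrite [leRHS]mulrCA ler_pM.
rewrite -normrM ger0_norm ?sqr_ge0// normr_nat normrX ler_wpM2l ?sqr_ge0//.
rewrite exprMn mulrCA ler_pM ?exprn_ge0//.
  by rewrite -natrX ler_nat ltnW// ltn_expl.
apply: (@le_trans _ _ (r ^+ n.-1)); first by rewrite lerXn2r ?nnegrE.
by rewrite -exprS ler_weXn2l// (leq_trans (leq_pred n)).
Qed.

(** The scalar remainder estimate for each power is summed against the exponential series, which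
    makes the quadratic remainder uniform on [[-r, r]]. *)
Lemma expm_taylor (r : R) : 0 <= r -> exists2 C : R, 0 <= C &
  forall x y, `|x| <= r -> `|y| <= r ->
    nrm (expm (x%:C *: A) - expm (y%:C *: A) -
         (x - y)%:C *: (A *m expm (y%:C *: A))) <= C * (x - y) ^+ 2.
Proof.
(* [taylor_expr_le] wants a radius at least 1. The constant [C] bounds all partial sums of the
   exponential series at [2 * r' * a]. *)
move=> r0; pose r' := r + 1.
have /cvg_seq_bounded/bounded_fun_has_ubound[C HC] :=
  is_cvg_series_exp_coeff (2 * r' * a).
have C0 : 0 <= C by apply: HC; exists 0%N => //; rewrite /series /= big_geq.
exists C => // x y xr yr.
have r'1 : 1 <= r' by rewrite lerDr.
have xr' : `|x| <= r' by rewrite (le_trans xr)// lerDl.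
have yr' : `|y| <= r' by rewrite (le_trans yr)// lerDl.
have shift z : expm_partial z q.+1 @[q --> \oo] --> expm (z%:C *: A).
  by rewrite cvg_shiftS; exact: expm_partial_cvg.
(* The derivative of the partial sum with [q.+1] terms is [A] times the one with [q] terms, so this
   shift matches the remainders term by term. *)
have : expm_partial x q.+1 - expm_partial y q.+1 -
    (x - y)%:C *: (A *m expm_partial y q) @[q --> \oo] -->
    expm (x%:C *: A) - expm (y%:C *: A) - (x - y)%:C *: (A *m expm (y%:C *: A)).
  apply: cvgB; first exact: cvgB (shift x) (shift y).
  by apply: cvgZl_tmp; apply: cvg_mulmxl; exact: expm_partial_cvg.
move=> /cvg_nrm_le; apply => q.
have -> : expm_partial x q.+1 - expm_partial y q.+1 -
    (x - y)%:C *: (A *m expm_partial y q) =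
    \sum_(n < q.+1) ((n`!%:R)^-1 *
      (x ^+ n - y ^+ n - (x - y) * (n%:R * y ^+ n.-1)))%:C *: A ^+ n.
  rewrite /expm_partial /series /= !big_mkord mulmx_sumr scaler_sumr.
  have -> : \sum_(i < q) (x - y)%:C *: (A *m ((exp_coeff y i)%:C *: A ^+ i)) =
      \sum_(n < q.+1) ((n`!%:R)^-1 * ((x - y) * (n%:R * y ^+ n.-1)))%:C *: A ^+ n.
    rewrite [RHS]big_ord_recl /= mul0r !mulr0 rmorph0 scale0r add0r.
    apply: eq_bigr => i _; rewrite -scalemxAr scalerA -realcM.
    rewrite -[A *m A ^+ i]/(A * A ^+ i) -exprS; congr (_%:C *: _).
    rewrite exp_coeffE /bump /= factS natrM.
    have f0 : (i`!%:R : R) != 0 by rewrite pnatr_eq0 -lt0n fact_gt0.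
    have i0 : (i.+1%:R : R) != 0 by rewrite pnatr_eq0.
    rewrite add1n add0n; move: f0 i0; move: (i`!%:R) (i.+1%:R) => f c f0 c0.
    by field; rewrite f0 c0.
  rewrite -!sumrB; apply: eq_bigr => i _.
  by rewrite -!scalerBl -!rmorphB !exp_coeffE; congr (_%:C *: _); ring.
apply: le_trans (nrm_sum _ _) _.
apply: (@le_trans _ _ (\sum_(n < q.+1) exp_coeff (2 * r' * a) n * (x - y) ^+ 2)).
  apply: ler_sum => n _; rewrite nrmZ normrM normfV normr_nat exp_coeffE /=.
  rewrite -[leLHS]mulrA -[leRHS]mulrA ler_wpM2l ?invr_ge0// [leRHS]mulrC.
  rewrite exprMn [leRHS]mulrA.
  by apply: ler_pM; rewrite ?nrm_ge0 ?taylor_expr_le ?nrm_expr.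
rewrite -mulr_suml ler_wpM2r ?sqr_ge0//.
by apply: HC; exists q.+1 => //; rewrite /series /= big_mkord.
Qed.

(** Mean value inequality for [s |-> A^-1 e^(s A) v], of derivative [e^(s A) v]. *)
Lemma invmx_expmB_le k (v : 'cV[R[i]]_N) : A \in unitmx -> 0 <= k ->
  (forall t, 0 <= t -> nrm (expm (t%:C *: A) *m v) <= nrm v) ->
  nrm (invmx A *m (expm (k%:C *: A) *m v - v)) <= k * nrm v.
Proof.
move=> Au k0 contr.
pose f (s : R) := invmx A *m (expm (s%:C *: A) *m v).
have f0 : f 0 = invmx A *m v by rewrite /f expm0 mul1mx.
have -> : invmx A *m (expm (k%:C *: A) *m v - v) = f k - f 0.
  by rewrite f0 mulmxBr.
have -> : k * nrm v = nrm v * (k - 0) by rewrite subr0 mulrC.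
apply: derivative_mean_value => // s e /andP[s0 sk] e0.
have [C C0 HC] := expm_taylor k0.
(* The quadratic remainder contributes at most [c * (r - s) ^+ 2], which [|r - s| <= e / (c + 1)]
   turns into at most [e * |r - s|]. *)
pose c := N%:R * nrm (invmx A) * (N%:R * C * nrm v).
have c0 : 0 <= c by rewrite !mulr_ge0 ?nrm_ge0.
have ec : 0 < e / (c + 1) by rewrite divr_gt0// ltr_wpDl.
have near_s : \forall r \near s, `|s - r| <= e / (c + 1).
  exact: (@cvgrPdist_le R R^o R (nbhs s) _ id s).1 cvg_id _ ec.
rewrite near_withinE; move: near_s.
apply: (@filterS _ (nbhs s)) => r rs; rewrite /= in_itv /= => /andP[rge0 rk].
set D := expm (r%:C *: A) - expm (s%:C *: A) - (r - s)%:C *: (A *m expm (s%:C *: A)).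
(* In the first-order part [invmx A] cancels [A], leaving [expm (s%:C *: A) *m v], of norm at most
   [nrm v]. *)
have -> : f r - f s =
    (r - s)%:C *: (expm (s%:C *: A) *m v) + invmx A *m (D *m v).
  rewrite /f -mulmxBr -mulmxBl -[expm _ - _](subrK ((r - s)%:C *: (A *m expm (s%:C *: A)))) -/D.
  by rewrite mulmxDl mulmxDr addrC -!scalemxAl -scalemxAr -mulmxA mulKmx.
apply: le_trans (nrmD _ _) _; rewrite mulrDl; apply: lerD.
  by rewrite nrmZ mulrC ler_wpM2r// contr.
have HD : nrm D <= C * (r - s) ^+ 2.
  by apply: HC; rewrite ger0_norm.
apply: (@le_trans _ _ (c * (r - s) ^+ 2)).
  apply: le_trans (nrm_mulmx _ _) _; rewrite /c -!mulrA ler_wpM2l//.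
  rewrite ler_wpM2l ?nrm_ge0//.
  apply: le_trans (nrm_mulmx _ _) _; rewrite -!mulrA ler_wpM2l//.
  by rewrite [nrm v * _]mulrC mulrA ler_wpM2r ?nrm_ge0.
rewrite -real_normK ?num_real// expr2 mulrA ler_wpM2r//.
move: rs; rewrite distrC ler_pdivlMr ?ltr_wpDl// => rs.
by apply: le_trans rs; rewrite mulrC ler_wpM2l// lerDl.
Qed.

End matrix_exponential.

(** * The exponential and the inverse matrix *)

Section matrix_exponential_inverse.
Variables (R : realType) (N : nat) (A : 'M[R[i]]_N).
Hypothesis Au : A \in unitmx.

Lemma invmx_expm_comm (x : R) :
  invmx A *m expm (x%:C *: A) = expm (x%:C *: A) *m invmx A.
Proof.
by rewrite -{1}[expm _](mulmxK Au) -expm_comm mulmxA mulKmx.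
Qed.

(** Trades [v] for [invmx A *m v]: with [v = C_h g], the bounds on [tau A e^(tau A)] and on
    [A^-1 C_h] become applicable. *)
Lemma expm_mulVmx (x : R) (v : 'cV[R[i]]_N) :
  expm (x%:C *: A) *m v = A *m expm (x%:C *: A) *m (invmx A *m v).
Proof. by rewrite expm_comm -mulmxA mulKVmx. Qed.

End matrix_exponential_inverse.

(** The inhomogeneity is split as [g + f], where [f] grows linearly along the
    stages while only [tau * e^(tau A) g] is under control. The latter suffices
    because each summand of a stage carries the factor [k = tau / (c_i - c_j)]. *)
Lemma lawson_stage_bounded (R : realType) (s : nat) (rk : tableau R s)
    (T M B L : R) (m : nat) :
  (forall i j : 'I_s, (i < j)%N -> rkc rk i < rkc rk j) ->
  0 <= T -> 0 <= M -> 0 <= B -> 0 <= L ->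
  exists2 K : R, 0 <= K &
  forall N (A : 'M[R[i]]_N) (g : R -> 'cV[R[i]]_N)
      (f : R -> 'cV[R[i]]_N -> 'cV[R[i]]_N) (t k : R) (v : 'cV[R[i]]_N),
    let K_ := lawson_stage rk A (fun r x => g r + f r x) t k v in
    0 < k <= T ->
    (forall i, 0 <= rkc rk i) ->
    (forall tau (x : 'cV[R[i]]_N), 0 <= tau -> nrm (expm (tau%:C *: A) *m x) <= nrm x) ->
    (forall tau i, 0 <= tau ->
      nrm (tau%:C *: (expm (tau%:C *: A) *m g (t + rkc rk i * k))) <= B) ->
    nrm v <= M ->
    (forall i, nrm (f (t + rkc rk i * k) (K_ i)) <= B + L * nrm (K_ i)) ->
    forall i : 'I_s, (i < m)%N -> nrm (K_ i) <= K.
Proof.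
move=> cinc T0 M0 B0 L0; pose c := rkc rk.
(* The induction is on the number of stages already bounded; [K] is chosen before the dimension, the
   matrix and [k], hence uniformly in them. *)
elim: m => [|m [K K0 IH]]; first by exists 0.
(* [bnd i j] majorizes summand [j] of stage [i]: [B / |c i - c j|] comes from
   [k = tau / (c i - c j)], and [T * (B + L * K)] from [k <= T] and the bound [K] on earlier
   stages. *)
pose bnd i j := `|rka rk i j| * (B / `|c i - c j| + T * (B + L * K)).
have bnd0 i j : 0 <= bnd i j.
  by rewrite mulr_ge0// addr_ge0 ?divr_ge0// mulr_ge0// addr_ge0// mulr_ge0.
have sum0 : 0 <= \sum_i \sum_j bnd i j.
  by apply: sumr_ge0 => i _; exact: sumr_ge0.
exists (K + (M + \sum_i \sum_j bnd i j)); first by rewrite !addr_ge0.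
move=> N A g f t k v K_ kT c0 contr gB vM fB i.
have {}IH := IH N A g f t k v kT c0 contr gB vM fB.
rewrite ltnS leq_eqVlt => /orP[/eqP im|im]; last first.
  by apply: le_trans (IH i im) _; rewrite lerDl addr_ge0.
apply: (@le_trans _ _ (M + \sum_i \sum_j bnd i j)); last by rewrite lerDr.
case/andP: kT => k0 kT.
rewrite /K_ lawson_stageE /lawson_stage_rhs -/K_.
apply: le_trans (nrmD _ _) _; apply: lerD.
  by apply: le_trans vM; apply: contr; rewrite mulr_ge0// ltW.
(* Only row [i] of the double sum is needed here; summing over all rows makes the constant
   independent of [i]. *)
rewrite [leRHS](bigD1 i)//= -[leLHS]addr0; apply: lerD; last first.
  by apply: sumr_ge0 => ? _; exact: sumr_ge0.
rewrite scaler_sumr; apply: le_trans (nrm_sum _ _) _.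
rewrite big_mkcond /=; apply: ler_sum => j _. case: ifPn => // ji.
have cij : 0 < c i - c j by rewrite subr_gt0; exact: cinc.
rewrite !nrmZ [`|k|]gtr0_norm// mulrCA /bnd ler_wpM2l//.
rewrite mulmxDr; apply: le_trans (ler_wpM2l (ltW k0) (nrmD _ _)) _.
rewrite mulrDr; apply: lerD.
  rewrite gtr0_norm// ler_pdivlMr// mulrAC [k * _]mulrC.
  have tau0 : 0 <= (c i - c j) * k by rewrite mulr_ge0 ?ltW.
  by have := gB _ j tau0; rewrite nrmZ ger0_norm.
apply: ler_pM => //; first exact: ltW.
  exact: nrm_ge0.
apply: le_trans (contr _ _ _) _; first by rewrite mulr_ge0 ?ltW.
apply: le_trans (fB j) _; rewrite lerD2l ler_wpM2l//.
by apply: IH; rewrite -im.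
Qed.

(** * Restriction to the grid *)

Section projection.
Variables (R : realType) (d : nat) (Omega : bounded_domain R d).
Variables (Y : normedModType R[i]) (D : discretization Omega Y).

Lemma PhB h x y : Ph D h (x - y) = Ph D h x - Ph D h y.
Proof. by apply/matrixP => i j; rewrite !mxE. Qed.

Lemma nrm_Ph_le h x : nrm (Ph D h x) <= nrm x.
Proof.
apply: nrm_mx_le => [|i j]; first exact: nrm_ge0.
by rewrite mxE nrm_le; exact: norm_le_max_norm.
Qed.

End projection.

(** * Bounds along the exact solution *)

Section continuous_bounds.
Variables (R : realType) (X Y : normedModType R[i]).
Variables (P : evolution_problem X Y).
Local Notation T := (horizon P).
Hypothesis hyp_cont : continuous_hypotheses P.

Lemma sol_bounded : exists2 M, 0 <= M &
  forall t, 0 <= t <= T -> nrm (sol P t) <= M.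
Proof.
have [u' uC1 _] := sol_equation hyp_cont.
have [M HM] := C1_path_bounded (ltW (horizon_gt0 hyp_cont)) uC1.
by exists `|M| => // t tT; apply: le_trans (HM t tT) (ler_norm M).
Qed.

Lemma bdata_bounded : exists2 M, 0 <= M &
  forall t, 0 <= t <= T -> nrm (bdata P t) <= M.
Proof.
have [g' gC1] := bdata_C1 hyp_cont.
have [M HM] := C1_path_bounded (ltW (horizon_gt0 hyp_cont)) gC1.
by exists `|M| => // t tT; apply: le_trans (HM t tT) (ler_norm M).
Qed.

Lemma sol_lipschitz : exists2 M, 0 <= M &
  forall a b, 0 <= a -> a <= b -> b <= T ->
    nrm (sol P b - sol P a) <= M * (b - a).
Proof.
have [u' uC1 _] := sol_equation hyp_cont.
have [M HM] := C1_path_lipschitz uC1; exists `|M| => // a b a0 ab bT.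
apply: le_trans (HM a b a0 ab bT) _.
by rewrite ler_wpM2r ?subr_ge0// ler_norm.
Qed.

(** By the equation, [f(t, u) = u' - A u], a difference of two functions continuous on [[0, T]]. *)
Lemma src_sol_bounded : exists2 M, 0 <= M &
  forall t, 0 <= t <= T -> nrm (src P t (sol P t)) <= M.
Proof.
have [u' [_ /continuous_within_bounded[M1 HM1]] uE] := sol_equation hyp_cont.
have [M2 HM2] := continuous_within_bounded (sol_A_continuous hyp_cont).
exists `|M1 + M2| => // t tT; apply: le_trans (ler_norm _).
have -> : src P t (sol P t) = u' t - opA P (sol P t).
  by rewrite uE// addrC addKr.
by apply: le_trans (nrmBD _ _) _; rewrite lerD ?HM1 ?HM2.
Qed.

End continuous_bounds.

(** * Bounds uniform in the mesh parameter *)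

Section discretization_bounds.
Variables (R : realType) (d : nat) (Omega : bounded_domain R d).
Variables (Y : normedModType R[i]).
Variables (P : evolution_problem (Cbar Omega) Y) (D : discretization Omega Y).
Variables (s : nat) (rk : tableau R s).
Hypothesis hyp_cont : continuous_hypotheses P.
Hypothesis hyp_disc : discretization_hypotheses P D rk.
Local Notation T := (horizon P).

Lemma expm_Ah0_le h (t : R) (v : 'cV[R[i]]_(nnodes D h)) : mesh D h -> 0 <= t ->
  nrm (expm (t%:C *: Ah0 D h) *m v) <= nrm v.
Proof.
move=> mh t0; rewrite -[leRHS]mul1r; apply: le_mxopnorm.
exact: (Ah0_contractive hyp_disc).
Qed.

Lemma Ah0_inv_le : exists2 C, 0 <= C &
  forall h (v : 'cV[R[i]]_(nnodes D h)), mesh D h -> nrm (invmx (Ah0 D h) *m v) <= C * nrm v.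
Proof.
have [C HC] := Ah0_inv_bounded hyp_disc; exists `|C| => // h v mh.
by apply: le_mxopnorm; apply: le_trans (HC h mh) (ler_norm C).
Qed.

Lemma Ch_bounded h : mesh D h -> bounded_real_linear (Ch D h).
Proof. by move=> /(Ch_continuous hyp_disc); exact: continuous_linear_bounded. Qed.

Lemma Ah0_inv_Ch_le : exists2 C, 0 <= C &
  forall h y, mesh D h -> nrm (invmx (Ah0 D h) *m Ch D h y) <= C * nrm y.
Proof.
have [C HC] := Ah0_inv_Ch_bounded hyp_disc; exists `|C| => // h y mh.
(* [M] may depend on [h]: it only certifies that the supremum in [opnorm] is a genuine bound, whose
   uniform size [C] is already known. *)
have [_ [M HM]] := Ch_bounded mh.
apply: (@le_opnormW _ _ _ (fun y => invmx (Ah0 D h) *m Ch D h y)); last first.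
  exact: le_trans (HC h mh) (ler_norm C).
split; first by move=> a x z; rewrite linearP mulmxDr -scalemxAr.
have [C1 C10 HC1] := Ah0_inv_le.
exists (C1 * M) => x; apply: le_trans (HC1 h _ mh) _.
by rewrite -mulrA ler_wpM2l.
Qed.

(** Inside the tube [fh] is Lipschitz, and at the grid values of the exact solution it is the
    restriction of [f(t, u(t))], bounded independently of [h]. The constants are free of the radius
    [r h]. *)
Lemma fh_stage_le : exists2 B, 0 <= B & exists2 L, 0 <= L &
  forall h k n i, mesh D h -> 0 < k -> n.+1%:R * k <= T -> 0 <= rkc rk i <= 1 ->
    nrm (fh D h (n%:R * k + rkc rk i * k) (Kbar P D rk h k n i))
      <= B + L * nrm (Kbar P D rk h k n i).
Proof.
have [M M0 HM] := sol_bounded hyp_cont.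
have [F F0 HF] := src_sol_bounded hyp_cont.
have [ft [fv [r [L HL]]]] := fh_C1 hyp_disc.
exists (F + `|L| * M); first by rewrite addr_ge0// mulr_ge0.
exists `|L| => // h k n i mh k0 nT /andP[c0 c1].
have [fC1 r0 tube stage] := HL h mh.
set t := n%:R * k + rkc rk i * k; set K := Kbar _ _ _ _ _ _ _.
have tT : 0 <= t <= T.
  rewrite addr_ge0 ?mulr_ge0 ?(ltW k0)//=; apply: le_trans nT.
  by rewrite -natr1 mulrDl mul1r lerD2l ler_piMl// ltW.
have fK : nrm (fh D h t K - fh D h t (Ph D h (sol P t)))
    <= `|L| * nrm (K - Ph D h (sol P t)).
  apply: le_trans (_ : _ <= L * nrm (K - Ph D h (sol P t))) _; last first.
    by rewrite ler_wpM2r ?nrm_ge0// ler_norm.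
  apply: (C1_strip_lipschitz fC1 tT (r := r h)) => [x xr|]; first exact: tube.
  exact: stage.
rewrite -(subrK (fh D h t (Ph D h (sol P t))) (fh _ _ _ _)).
apply: le_trans (nrmD _ _) _.
have -> : F + `|L| * M + `|L| * nrm K = `|L| * (nrm K + M) + F by ring.
apply: lerD.
  apply: le_trans fK _; rewrite ler_wpM2l//; apply: le_trans (nrmBD _ _) _.
  by rewrite lerD2l; apply: le_trans (nrm_Ph_le _ _ _) (HM t tT).
rewrite -(fhP hyp_disc)//.
by apply: le_trans (nrm_Ph_le _ _ _) (HF t tT).
Qed.

End discretization_bounds.

(** * The two local error estimates *)

Theorem theorem6 (R : realType) (d : nat) (Omega : bounded_domain R d)
    (Y : completeNormedModType R[i])
    (P : evolution_problem (Cbar Omega) Y) (D : discretization Omega Y)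
    (s : nat) (rk : tableau R s) (C' h0 : R)
    (hyp_cont : continuous_hypotheses P)
    (hyp_disc : discretization_hypotheses P D rk)
    (bdry_sol_neq0 : exists2 t, 0 <= t <= horizon P & bdry P (sol P t) <> 0)
    (rkc_range : forall i, 0 <= rkc rk i <= 1)
    (rkc_increasing : forall i j : 'I_s, (i < j)%N -> rkc rk i < rkc rk j)
    (rkc_eq1 : exists i, rkc rk i = 1)
    (h0_gt0 : 0 < h0)
    (analytic : forall h tau, mesh D h -> h <= h0 -> 0 <= tau ->
      mxopnorm (tau%:C *: (Ah0 D h *m expm (tau%:C *: Ah0 D h))) <= C') :
  exists C : R, forall (h k : R) (n : nat),
    mesh D h -> h <= h0 -> 0 < k -> n.+1%:R * k <= horizon P ->
    nrm (local_error P D rk h k n) <= C * (1 + k * opnorm (Ch D h)) /\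
    nrm (invmx (Ah0 D h) *m local_error P D rk h k n) <= C * k.
Proof.
have T0 := ltW (horizon_gt0 hyp_cont).
have [M M0 HM] := sol_bounded hyp_cont.
have [M1 M10 HM1] := sol_lipschitz hyp_cont.
have [G G0 HG] := bdata_bounded hyp_cont.
have [C1 C10 HC1] := Ah0_inv_le hyp_disc.
have [C2 C20 HC2] := Ah0_inv_Ch_le hyp_disc.
have [B B0 [L L0 HF]] := fh_stage_le hyp_cont hyp_disc.
(* One constant for two uses: the first summand bounds [tau e^(tau A) C_h g], the second is the
   constant term in the affine bound on [fh]. *)
pose B' := `|C'| * (C2 * G) + B.
have B'0 : 0 <= B' by rewrite addr_ge0// !mulr_ge0.
have [K K0 HK] := lawson_stage_bounded s rkc_increasing T0 M0 B'0 L0.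
pose F := B + L * K.
have F0 : 0 <= F by rewrite addr_ge0// mulr_ge0.
pose b := \sum_i `|rkb rk i|.
have b0 : 0 <= b by exact: sumr_ge0.
(* The terms up to [horizon P * (b * F)] serve the error itself, the remaining ones the error
   multiplied by [A^-1]. *)
pose C := M + M + b * G + horizon P * (b * F) + M + C1 * M1 + b * (C2 * G + C1 * F).
have bG0 : 0 <= b * G by rewrite mulr_ge0.
have TbF0 : 0 <= horizon P * (b * F) by rewrite !mulr_ge0.
have CM0 : 0 <= C1 * M1 by rewrite mulr_ge0.
have bC0 : 0 <= b * (C2 * G + C1 * F) by rewrite mulr_ge0// addr_ge0// mulr_ge0.
exists C => h k n mh hh0 k0 nT.
set A := Ah0 D h.
have Au : A \in unitmx by exact: (Ah0_unit hyp_disc).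
have contr (t : R) (v : 'cV[R[i]]_(nnodes D h)) : 0 <= t -> nrm (expm (t%:C *: A) *m v) <= nrm v.
  by move=> t0; exact: (expm_Ah0_le hyp_disc).
have nk0 : 0 <= n%:R * k by rewrite mulr_ge0// ltW.
have nSk : n.+1%:R * k = n%:R * k + k by rewrite -natr1 mulrDl mul1r.
have kT : k <= horizon P by apply: le_trans nT; rewrite nSk lerDr.
have tT i : 0 <= n%:R * k + rkc rk i * k <= horizon P.
  have /andP[c0 c1] := rkc_range i.
  rewrite addr_ge0 ?mulr_ge0 ?(ltW k0)//=; apply: le_trans nT.
  by rewrite nSk lerD2l ler_piMl// ltW.
set v := Ph D h (sol P (n%:R * k)).
set w := Ph D h (sol P (n.+1%:R * k)).
have vM : nrm v <= M.
  apply: le_trans (nrm_Ph_le _ _ _) (HM _ _).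
  by rewrite nk0 (le_trans _ nT)// nSk lerDl ltW.
have wM : nrm w <= M.
  by apply: le_trans (nrm_Ph_le _ _ _) (HM _ _); rewrite nT nSk addr_ge0// ltW.
have vw : nrm (v - w) <= M1 * k.
  rewrite nrmB -PhB; apply: le_trans (nrm_Ph_le _ _ _) _.
  apply: le_trans (HM1 _ _ nk0 _ nT) _; first by rewrite nSk lerDl ltW.
  by rewrite nSk addrAC subrr add0r.
have KK i : nrm (Kbar P D rk h k n i) <= K.
  apply: (HK _ A (fun t => Ch D h (bdata P t)) (fh D h)) => //.
  - by rewrite k0.
  - by move=> j; case/andP: (rkc_range j).
  - move=> tau j tau0; rewrite expm_mulVmx// scalemxAl.
    apply: le_trans (le_mxopnorm _ (le_trans (analytic h tau mh hh0 tau0) (ler_norm C'))) _.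
    rewrite -[leLHS]addr0 lerD// ler_wpM2l//.
    by apply: le_trans (HC2 h _ mh) _; rewrite ler_wpM2l// HG.
  - move=> j; apply: le_trans (HF h k n j mh k0 nT (rkc_range j)) _.
    by rewrite lerD2r lerDr !mulr_ge0.
pose f i := fh D h (n%:R * k + rkc rk i * k) (Kbar P D rk h k n i).
have fF i : nrm (f i) <= F.
  apply: le_trans (HF h k n i mh k0 nT (rkc_range i)) _.
  by rewrite lerD2l ler_wpM2l.
pose g i := Ch D h (bdata P (n%:R * k + rkc rk i * k)).
have cT i : 0 <= (1 - rkc rk i) * k.
  by rewrite mulr_ge0 ?(ltW k0)// subr_ge0; case/andP: (rkc_range i).
pose S := \sum_i (rkb rk i)%:C *: (expm (((1 - rkc rk i) * k)%:C *: A) *m (g i + f i)).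
have errE : local_error P D rk h k n = expm (k%:C *: A) *m v - w + k%:C *: S.
  by rewrite /local_error addrAC.
have sum_le (a : R) (x : 'I_s -> 'cV[R[i]]_(nnodes D h)) : (forall i, nrm (x i) <= a) ->
    nrm (\sum_i (rkb rk i)%:C *: (expm (((1 - rkc rk i) * k)%:C *: A) *m x i)) <= b * a.
  move=> xa; apply: le_trans (nrm_sum _ _) _; rewrite mulr_suml.
  apply: ler_sum => i _; rewrite nrmZ ler_wpM2l//.
  exact: le_trans (contr _ _ (cT i)) (xa i).
rewrite errE; split.
- apply: le_trans (nrmD _ _) _; rewrite nrmZ gtr0_norm//.
  set c := opnorm _.
  have c0 : 0 <= c by apply: opnorm_ge0; exact: (Ch_bounded hyp_disc).
  (* Since [1 - c_i] may vanish, no smoothing is available; [C_h] is estimated by its norm [c],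
     which yields the term [k * c]. *)
  have SB : nrm S <= b * (c * G + F).
    apply: sum_le => i; apply: le_trans (nrmD _ _) _; apply: lerD => //.
    apply: le_trans (le_opnorm _ (Ch_bounded hyp_disc mh)) _.
    by rewrite ler_wpM2l// HG.
  apply: le_trans (lerD (nrmBD _ _) (ler_wpM2l (ltW k0) SB)) _.
  have ev : nrm (expm (k%:C *: A) *m v) <= M.
    exact: le_trans (contr _ _ (ltW k0)) vM.
  apply: (@le_trans _ _ (M + M + horizon P * (b * F) + b * G * (k * c))).
    have -> : k * (b * (c * G + F)) = k * (b * F) + b * G * (k * c) by ring.
    rewrite addrA lerD2r lerD ?lerD//.
    by rewrite ler_wpM2r// mulr_ge0.
  have kc0 : 0 <= k * c by rewrite mulr_ge0// ltW.
  rewrite [leRHS]mulrDr mulr1; apply: lerD; last first.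
    by rewrite ler_wpM2r// /C; lra.
  by rewrite /C; lra.
(* Inserting [A^-1 v] separates the action of the exponential from the increment of the solution; in
   the sum, [A^-1] commutes past the exponentials to reach [C_h g]. *)
- have -> : invmx A *m (expm (k%:C *: A) *m v - w + k%:C *: S) =
      invmx A *m (expm (k%:C *: A) *m v - v) + invmx A *m (v - w) +
      k%:C *: (\sum_i (rkb rk i)%:C *: (expm (((1 - rkc rk i) * k)%:C *: A) *m
        (invmx A *m (g i + f i)))).
    rewrite -mulmxDr addrA subrK mulmxDr -scalemxAr mulmx_sumr.
    congr (_ + _ *: _); apply: eq_bigr => i _.
    by rewrite -scalemxAr !mulmxA invmx_expm_comm.
  have SB := sum_le (C2 * G + C1 * F) (fun i => invmx A *m (g i + f i)).
  apply: le_trans (nrmD _ _) _; rewrite nrmZ gtr0_norm//.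
  apply: (@le_trans _ _ (k * M + C1 * (M1 * k) + k * (b * (C2 * G + C1 * F)))); last first.
    have -> : k * M + C1 * (M1 * k) + k * (b * (C2 * G + C1 * F)) =
        k * (M + C1 * M1 + b * (C2 * G + C1 * F)) by ring.
    by rewrite [leRHS]mulrC ler_wpM2l ?(ltW k0)// /C; lra.
  apply: lerD.
    apply: le_trans (nrmD _ _) _; apply: lerD.
      apply: le_trans (invmx_expmB_le Au (ltW k0) (fun t => contr t v)) _.
      by rewrite ler_wpM2l// ltW.
    by apply: le_trans (HC1 h _ mh) _; rewrite ler_wpM2l.
  rewrite ler_wpM2l ?(ltW k0)//; apply: SB => i; rewrite mulmxDr.
  apply: le_trans (nrmD _ _) _; apply: lerD.
    by apply: le_trans (HC2 h _ mh) _; rewrite ler_wpM2l// HG.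
  by apply: le_trans (HC1 h _ mh) _; rewrite ler_wpM2l.
Qed.
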